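(* Let $a,b$ be nonzero real numbers, let $\mathcal{F}_n=\mathcal{F}_n(a,b,x)$ be the bi-periodic Fibonacci matrix polynomials, let $\mathcal{A}_{n}(a,b,x)=\sqrt{x}\,a^{\varepsilon(n)/2}b^{(1-\varepsilon(n))/2}\mathcal{F}_{n}(a,b,x)$, let $k=x\sqrt{ab}$, and let $w_n(a,b,x)=\sum_{i=0}^{n}\binom{n}{i}k^{n}\mathcal{A}_i(a,b,x)$ be the $k$-binomial transform ($n\ge 0$). Then: (1) for all $n\ge 1$, $w_{n+1}(a,b,x)=(abx^{2}+2x\sqrt{ab})\,w_{n}(a,b,x)-abx^{3}\sqrt{ab}\,w_{n-1}(a,b,x)$; (2) as formal power series in $t$, $$\sum_{n=0}^{\infty}w_n(a,b,x)t^n=\frac{\sqrt{bx}\,\mathcal{F}_{0}(a,b,x)+t\left(ax\sqrt{bx}\,\mathcal{F}_{1}(a,b,x)-\left(bx\sqrt{ax}+abx^{2}\sqrt{bx}\right)\mathcal{F}_{0}(a,b,x)\right)}{1-(abx^{2}+2x\sqrt{ab})t+abx^{3}\sqrt{ab}\,t^{2}};$$ (3) for all $n\ge 0$, $$w_{n}(a,b,x)=C\left(r_{4}^{n}(x)-r_{3}^{n}(x)\right)+\frac{\sqrt{bx}\,\mathcal{F}_{0}(a,b,x)}{2}\left(r_{4}^{n}(x)+r_{3}^{n}(x)\right),$$ where $r_3(x),r_4(x)$ are the roots of $r^{2}-(2x\sqrt{ab}+abx^{2})r+x^{3}ab\sqrt{ab}=0$ and $$C=\frac{bx\sqrt{a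x}\,\mathcal{F}_{0}(a,b,x)-2\sqrt{ax}\,\mathcal{F}_{1}(a,b,x)}{2\sqrt{abx^{2}+4}}.$$
   Context: Here $\varepsilon(n)=n-2\lfloor n/2\rfloor$ and $x$ is an indeterminate over $\mathbb{R}$; everything takes place in an algebraic closure of $\mathbb{R}(x)$, in which square roots $\sqrt a,\sqrt b,\sqrt x,\sqrt{abx^2+4}$ are fixed once and for all, with $\sqrt{ab}=\sqrt a\sqrt b$, $\sqrt{ax}=\sqrt a\sqrt x$, $\sqrt{bx}=\sqrt b\sqrt x$, and half-integer powers of $a$ and $b$ are taken with respect to $\sqrt a,\sqrt b$. The roots are labelled so that $r_3(x)-r_4(x)=x\sqrt{ab}\,\sqrt{abx^2+4}$. The bi-periodic Fibonacci matrix polynomials are the $2\times 2$ matrices defined by $\mathcal{F}_0(a,b,x)=\begin{pmatrix}1&0\\0&1\end{pmatrix}$, $\mathcal{F}_1(a,b,x)=\begin{pmatrix}bx&\frac{b}{a}\\1&0\end{pmatrix}$ and, for $n\ge 2$, $\mathcal{F}_n=ax\,\mathcal{F}_{n-1}+\mathcal{F}_{n-2}$ if $n$ is even, $\mathcal{F}_n=bx\,\mathcal{F}_{n-1}+\mathcal{F}_{n-2}$ if $n$ is odd. *)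

(* Defs.v *)
From HB Require Import structures.
From mathcomp Require Import all_boot all_order all_algebra.
From mathcomp Require Import boolp reals.

Set Implicit Arguments.
Unset Strict Implicit.
Unset Printing Implicit Defensive.

Import GRing.Theory.
Local Open Scope ring_scope.

Record fps (K : Type) := Fps { fps_coef : nat -> K }.

Lemma fpsP (K : Type) (f g : fps K) : fps_coef f =1 fps_coef g -> f = g.
Proof. by case: f => f; case: g => g /= /funext ->. Qed.

HB.instance Definition _ (K : Type) := gen_eqMixin (fps K).
HB.instance Definition _ (K : Type) := gen_choiceMixin (fps K).

Section FpsRing.
Variable K : comUnitRingType.
Implicit Types f g h : fps K.

Definition fps_zero : fps K := Fps (fun=> 0).
Definition fps_opp f := Fps (fun n => - fps_coef f n).
Definition fps_add f g := Fps (fun n => fps_coef f n + fps_coef g n).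

Lemma fps_addA : associative fps_add.
Proof. by move=> f g h; apply: fpsP => n /=; rewrite addrA. Qed.
Lemma fps_addC : commutative fps_add.
Proof. by move=> f g; apply: fpsP => n /=; rewrite addrC. Qed.
Lemma fps_add0 : left_id fps_zero fps_add.
Proof. by move=> f; apply: fpsP => n /=; rewrite add0r. Qed.
Lemma fps_addN : left_inverse fps_zero fps_opp fps_add.
Proof. by move=> f; apply: fpsP => n /=; rewrite addNr. Qed.

HB.instance Definition _ :=
  GRing.isZmodule.Build (fps K) fps_addA fps_addC fps_add0 fps_addN.

Definition fpsC (c : K) : fps K := Fps (fun n => if n == 0%N then c else 0).
Definition fpsX : fps K := Fps (fun n => (n == 1%N)%:R).
Definition fps_mul f g :=
  Fps (fun n => \sum_(i < n.+1) fps_coef f i * fps_coef g (n - i)).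

Let trunc N f : {poly K} := \poly_(i < N) fps_coef f i.

Let coef_trunc_mul N f g n : (n < N)%N ->
  fps_coef (fps_mul f g) n = (trunc N f * trunc N g)`_n.
Proof.
move=> nN; rewrite coefM /=; apply: eq_bigr => i _; rewrite !coef_poly.
by rewrite (leq_ltn_trans (leq_ord i) nN) (leq_ltn_trans (leq_subr i n) nN).
Qed.

Let trunc_mul_coef N f (p : {poly K}) n : (n < N)%N ->
  \sum_(i < n.+1) p`_i * fps_coef f (n - i) = (p * trunc N f)`_n.
Proof.
move=> nN; rewrite coefM; apply: eq_bigr => i _; rewrite coef_poly.
by rewrite (leq_ltn_trans (leq_subr i n) nN).
Qed.

Lemma fps_mulC : commutative fps_mul.
Proof.
by move=> f g; apply: fpsP => n; rewrite !(coef_trunc_mul _ _ (ltnSn n)) mulrC.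
Qed.

Lemma fps_mulA : associative fps_mul.
Proof.
have aux f g h n : fps_coef (fps_mul (fps_mul f g) h) n =
    (trunc n.+1 f * trunc n.+1 g * trunc n.+1 h)`_n.
  rewrite -trunc_mul_coef //=; apply: eq_bigr => i _; congr (_ * _).
  exact: (@coef_trunc_mul n.+1 f g i (ltn_ord i)).
move=> f g h; apply: fpsP => n.
by rewrite [LHS](congr1 (fun u => fps_coef u n) (fps_mulC _ _)) !aux mulrC mulrA.
Qed.

Lemma fps_mul1 : left_id (fpsC 1) fps_mul.
Proof.
move=> f; apply: fpsP => n /=; rewrite big_ord_recl /= subn0 mul1r big1 ?addr0 //.
by move=> i _; rewrite mul0r.
Qed.

Lemma fps_mulDl : left_distributive fps_mul fps_add.
Proof.
move=> f g h; apply: fpsP => n /=; rewrite -big_split /=.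
by apply: eq_bigr => i _; rewrite mulrDl.
Qed.

Lemma fps_one_neq0 : fpsC 1 != 0.
Proof.
by apply/eqP => /(congr1 (fun f => fps_coef f 0)) /= /eqP; rewrite oner_eq0.
Qed.

HB.instance Definition _ := GRing.Zmodule_isComNzRing.Build (fps K)
  fps_mulA fps_mulC fps_mul1 fps_mulDl fps_one_neq0.

(* The first N coefficients of 1/f, when the constant term of f is a unit. *)
Fixpoint fps_inv_seq f (N : nat) : seq K :=
  if N is m.+1 then
    let s := fps_inv_seq f m in
    rcons s ((fps_coef f 0)^-1 *
             ((m == 0%N)%:R - \sum_(i < m) s`_i * fps_coef f (m - i)))
  else [::].

Definition fps_unit : pred (fps K) := fun f => fps_coef f 0 \is a GRing.unit.
Definition fps_inv f : fps K :=
  if fps_unit f then Fps (fun n => (fps_inv_seq f n.+1)`_n) else f.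

Let size_fps_inv_seq f N : size (fps_inv_seq f N) = N.
Proof. by elim: N => //= N IH; rewrite size_rcons IH. Qed.

Let nth_fps_inv_seq f N i : (i < N)%N ->
  (fps_inv_seq f N)`_i = (fps_inv_seq f i.+1)`_i.
Proof.
elim: N => // N IH; rewrite ltnS leq_eqVlt => /orP[/eqP -> //|iN].
by rewrite -IH //= nth_rcons size_fps_inv_seq iN.
Qed.

Lemma fps_mulV : {in fps_unit, left_inverse 1 fps_inv *%R}.
Proof.
move=> f uf; have uf1 : fps_unit f by []; apply: fpsP => n; rewrite /fps_inv uf1.
rewrite [LHS]big_ord_recr /= subnn nth_rcons size_fps_inv_seq ltnn eqxx.
rewrite mulrAC mulVr // mul1r [X in X + _](_ : _ =
  \sum_(i < n) (fps_inv_seq f n)`_i * fps_coef f (n - i)).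
  by rewrite addrC subrK; case: eqP.
by apply: eq_bigr => i _; rewrite [in RHS]nth_fps_inv_seq.
Qed.

Lemma fps_unitPl f g : g * f = 1 -> fps_unit f.
Proof.
move=> /(congr1 (fun u => fps_coef u 0)).
rewrite /= big_ord_recl big_ord0 addr0 /= subn0 => gf1.
by apply/unitrP; exists (fps_coef g 0); split; last rewrite mulrC.
Qed.

Lemma fps_inv_out : {in [predC fps_unit], fps_inv =1 id}.
Proof. by move=> f uf; rewrite /fps_inv ifN. Qed.

HB.instance Definition _ := GRing.ComNzRing_hasMulInverse.Build (fps K)
  fps_mulV fps_unitPl fps_inv_out.

End FpsRing.

Arguments fpsX {K}.

(* The power series sum_n (u n) t^n with matrix coefficients, read entrywise
   through the identification of M_{p,q}(K)[[t]] with M_{p,q}(K[[t]]). *)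
Definition mxseries (K : Type) p q (u : nat -> 'M[K]_(p, q)) : 'M[fps K]_(p, q) :=
  \matrix_(i, j) Fps (fun n => u n i j).

Definition parity (n : nat) : nat := (n - 2 * (n %/ 2))%N.

(* Entries lie in R[x]; only the scalar b / a involves a division, in R. *)
Fixpoint bifib (R : fieldType) (a b : R) (n : nat) : 'M[{poly R}]_2 :=
  match n with
  | 0 => 1%:M
  | 1 => \matrix_(i, j)
      nth 0 (nth [::] [:: [:: b *: 'X; (b / a)%:P]; [:: 1; 0]] i) j
  | (m.+1 as n').+1 =>
      ((if odd n then b else a) *: 'X) *: bifib a b n' + bifib a b m
  end.

Definition kbinomial (K : fieldType) (k : K) (A : nat -> 'M[K]_2) (n : nat) :=
  \sum_(0 <= i < n.+1) ('C(n, i)%:R * k ^+ n) *: A i.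

(* K is an algebraic closure of F through iota: K, being a closedFieldType, is
   algebraically closed, and it is algebraic over F. *)
Definition algebraic_closure (F : fieldType) (K : closedFieldType)
  (iota : {rmorphism F -> K}) : Prop := forall z : K, algebraicOver iota z.

Definition polyK (R : fieldType) (K : fieldType)
  (iota : {rmorphism {fraction {poly R}} -> K}) (p : {poly R}) : K :=
  iota (tofrac p).

(* Main.v *)
Require Import Defs.
From HB Require Import structures.
From mathcomp Require Import all_boot all_order all_algebra.
From mathcomp Require Import boolp reals.
From mathcomp Require Import ring.

(** Write s = sqrta * sqrtb and k = x * s. The weights sqrta ^+ parity n and
    sqrtb ^+ (1 - parity n) absorb the alternation of the coefficients a and b:
    since B * sqrta = s * sqrtb and A * sqrtb = s * sqrta, the weighted matrices
    satisfy the constant-coefficient recurrence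
    calA n.+2 = k *: calA n.+1 + calA n ([weighted_bifib_rec]).

    If E denotes the shift of sequences, then E ^ 2 = k E + 1 on calA and the
    k-binomial transform is w n = (k (1 + E)) ^ n calA evaluated at 0. The
    operator W = k (1 + E) satisfies W ^ 2 = (k ^ 2 + 2 k) W - k ^ 3, which is
    the recurrence of the first claim ([kbinomial_rec]). The other two claims
    are the standard consequences of a recurrence of order two, once the
    values of w 0 and w 1 are known: multiplication by the reciprocal
    of its characteristic polynomial collapses the generating function
    ([mxseries_rec]), and the powers of two distinct characteristic roots span its solutions
    ([binet_rec]). The discriminant of the characteristic polynomial is
    k ^ 2 * (A * B * x ^ 2 + 4), so the labelling r3 - r4 = k * sqrtD makes the
    roots distinct and forces r3 + r4 = k ^ 2 + 2 k. *)

Set Implicit Arguments.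
Unset Strict Implicit.
Unset Printing Implicit Defensive.

Import GRing.Theory.
Local Open Scope ring_scope.

(** * Binomial transform of a second-order recurrence *)

Section KBinomial.
Variables (K : fieldType).
Implicit Types (k : K) (A : nat -> 'M[K]_2).

Lemma kbinomial1E A n :
  kbinomial 1 A n = \sum_(0 <= i < n.+1) 'C(n, i)%:R *: A i.
Proof. by apply: eq_bigr => i _; rewrite expr1n mulr1. Qed.

Lemma kbinomialE k A n : kbinomial k A n = k ^+ n *: kbinomial 1 A n.
Proof.
rewrite kbinomial1E scaler_sumr; apply: eq_bigr => i _.
by rewrite scalerA mulrC.
Qed.

(** Pascal's rule: the binomial transform intertwines the shift E of its output
    with the operator 1 + E on its input. *)
Lemma binomial_shift A n :
  kbinomial 1 A n.+1 = kbinomial 1 A n + kbinomial 1 (A \o S) n.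
Proof.
rewrite !kbinomial1E big_nat_recl //= bin0.
under eq_bigr => i _ do rewrite binS natrD scalerDl.
rewrite big_split /= addrA; congr (_ + _).
(* The term of index n.+1 vanishes because 'C(n, n.+1) = 0. *)
rewrite [in RHS]big_nat_recl // bin0; congr (_ + _).
by rewrite big_nat_recr //= bin_small // scale0r addr0.
Qed.

Lemma kbinomial_rec k A n : (forall m, A m.+2 = k *: A m.+1 + A m) ->
  kbinomial k A n.+2
    = (k ^+ 2 + 2 * k) *: kbinomial k A n.+1 - k ^+ 3 *: kbinomial k A n.
Proof.
move=> recA.
have shift2 : kbinomial 1 (A \o S \o S) n
    = k *: kbinomial 1 (A \o S) n + kbinomial 1 A n.
  rewrite !kbinomial1E scaler_sumr -big_split /=; apply: eq_bigr => i _.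
  by rewrite recA scalerDr !scalerA [k * _]mulrC.
rewrite !(kbinomialE k) !binomial_shift shift2.
move: (kbinomial 1 A n) (kbinomial 1 (A \o S) n) => T0 T1.
by apply/matrixP => i j; rewrite !mxE !exprS; ring.
Qed.

Lemma kbinomial0 k A : kbinomial k A 0 = A 0%N.
Proof. by rewrite /kbinomial big_nat1 bin0 mul1r scale1r. Qed.

Lemma kbinomial1 k A : kbinomial k A 1 = k *: (A 0%N + A 1%N).
Proof. by rewrite kbinomialE expr1 binomial_shift !kbinomial0. Qed.

End KBinomial.

(** * Formal power series with a rational sum *)

Section PowerSeries.
Variable K : comUnitRingType.
Implicit Types (c : K) (f : fps K).

Lemma coef_fpsD f g n : fps_coef (f + g) n = fps_coef f n + fps_coef g n.
Proof. by []. Qed.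

Lemma coef_fpsN f n : fps_coef (- f) n = - fps_coef f n.
Proof. by []. Qed.

Lemma coef_fpsCM c f n : fps_coef (fpsC c * f) n = c * fps_coef f n.
Proof.
rewrite [LHS]big_ord_recl /= subn0 big1 ?addr0 // => i _.
by rewrite mul0r.
Qed.

Lemma coef_fpsXM f n :
  fps_coef (fpsX * f) n = if n is m.+1 then fps_coef f m else 0.
Proof.
case: n => [|n]; first by rewrite [LHS]big_ord1 /= mul0r.
rewrite [LHS]big_ord_recl /= mul0r add0r big_ord_recl /= mul1r.
rewrite [bump 0 _]/bump subSS subn0 big1 ?addr0 // => i _.
by rewrite mul0r.
Qed.

(** The product of the series by 1 - p t + q t ^ 2 has coefficient
    u n.+2 - p u n.+1 + q u n = 0 in degree n.+2, so only the terms of degree 0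
    and 1 survive; the factor is invertible as its constant term is 1. *)
Lemma mxseries_rec (p q : K) m n (u : nat -> 'M[K]_(m, n)) :
    (forall l, u l.+2 = p *: u l.+1 - q *: u l) ->
  mxseries u = (1 - fpsC p * fpsX + fpsC q * fpsX ^+ 2)^-1
    *: (map_mx (@fpsC K) (u 0%N)
        + fpsX *: map_mx (@fpsC K) (u 1%N - p *: u 0%N)).
Proof.
move=> recu; set d := 1 - _ + _.
have d_unit : d \is a GRing.unit.
  rewrite [_ \is a _]/(fps_coef d 0 \is a GRing.unit) /d expr2.
  rewrite !coef_fpsD coef_fpsN !coef_fpsCM coef_fpsXM /=.
  by rewrite !mulr0 subr0 addr0; exact: unitr1.
rewrite -[LHS]scale1r -(mulVr d_unit) -scalerA; congr (_ *: _).
apply/matrixP => i j; rewrite !mxE.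
apply: fpsP => l; rewrite /d expr2 !mulrDl mulNr mul1r -!mulrA.
rewrite !coef_fpsD coef_fpsN !coef_fpsCM !coef_fpsXM.
case: l => [|[|l]]; rewrite ?coef_fpsXM /=.
- by rewrite !mulr0 subr0.
- by rewrite mulr0 addr0 add0r.
- by rewrite recu !mxE; ring.
Qed.

End PowerSeries.

(** * Binet formula *)

(** Both sides satisfy the recurrence and have the same two initial values. *)
Lemma binet_rec (K : fieldType) (p q r s : K) m n (u : nat -> 'M[K]_(m, n))
    (c d : 'M[K]_(m, n)) :
    (forall l, u l.+2 = p *: u l.+1 - q *: u l) ->
    r ^+ 2 - p * r + q = 0 -> s ^+ 2 - p * s + q = 0 ->
    u 0%N = c + d -> u 1%N = r *: c + s *: d ->
  forall l, u l = r ^+ l *: c + s ^+ l *: d.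
Proof.
move=> recu rE sE u0 u1 l.
have powE z l' : z ^+ 2 - p * z + q = 0 ->
    z ^+ l'.+2 = p * z ^+ l'.+1 - q * z ^+ l'.
  move=> zE; have -> : q = p * z - z ^+ 2.
    by apply/eqP; rewrite -subr_eq0 -zE; apply/eqP; ring.
  by rewrite !exprS; ring.
suff: u l = r ^+ l *: c + s ^+ l *: d /\
      u l.+1 = r ^+ l.+1 *: c + s ^+ l.+1 *: d by case.
elim: l => [|l [IH0 IH1]]; first by rewrite !expr0 !scale1r !expr1.
split=> //; rewrite recu IH0 IH1 !(powE _ l) //.
by apply/matrixP => i j; rewrite !mxE; ring.
Qed.

(** * Weighted bi-periodic Fibonacci matrices *)

Lemma parityE n : parity n = odd n :> nat.
Proof. by rewrite /parity divn2 mul2n -{1}(odd_double_half n) addnK. Qed.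

(** Even indices carry the weight sb and odd ones the weight sa, and
    sb * (a x) = (x sa sb) * sa, sa * (b x) = (x sa sb) * sb: in either parity
    the coefficient of the recurrence turns into x sa sb as the weight changes
    from one index to the next. *)
Lemma weighted_bifib_rec (R K : fieldType) (phi : {rmorphism {poly R} -> K})
    (a b : R) (sa sb c : K) :
    sa ^+ 2 = phi a%:P -> sb ^+ 2 = phi b%:P ->
  let u n :=
    (c * sa ^+ parity n * sb ^+ (1 - parity n)) *: map_mx phi (bifib a b n) in
  forall n, u n.+2 = (phi 'X * (sa * sb)) *: u n.+1 + u n.
Proof.
move=> saE sbE u n; rewrite /u !parityE /= negbK.
rewrite map_mxD map_mxZ -[_ *: 'X]mul_polyC rmorphM /=.
by apply/matrixP => i j; rewrite !mxE; case: (odd n) => /=;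
   rewrite ?subnn ?subn0 ?expr0 ?expr1 -?saE -?sbE; ring.
Qed.

(** * The k-binomial transform of the bi-periodic Fibonacci matrices *)

Theorem mainTheorem6 (R : realType) (a b : R) (a_neq0 : a != 0) (b_neq0 : b != 0)
    (K : closedFieldType) (iota : {rmorphism {fraction {poly R}} -> K})
    (closureK : algebraic_closure iota)
    (sqrta sqrtb sqrtx sqrtD : K)
    (sqrtaE : sqrta ^+ 2 = polyK iota a%:P)
    (sqrtbE : sqrtb ^+ 2 = polyK iota b%:P)
    (sqrtxE : sqrtx ^+ 2 = polyK iota 'X)
    (sqrtDE : sqrtD ^+ 2 = polyK iota ((a * b) *: 'X^2 + 4%:P)) :
  let A := polyK iota a%:P in
  let B := polyK iota b%:P in
  let x := polyK iota 'X in
  let sqrtab := sqrta * sqrtb in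
  let sqrtax := sqrta * sqrtx in
  let sqrtbx := sqrtb * sqrtx in
  let F := fun n : nat => map_mx (polyK iota) (bifib a b n) in
  let calA := fun n : nat =>
    (sqrtx * sqrta ^+ parity n * sqrtb ^+ (1 - parity n)) *: F n in
  let k := x * sqrtab in
  let w := kbinomial k calA in
  [/\ forall n : nat, (1 <= n)%N ->
        w n.+1 = (A * B * x ^+ 2 + 2 * x * sqrtab) *: w n
                 - (A * B * x ^+ 3 * sqrtab) *: w n.-1,
      mxseries w =
        (1 - fpsC (A * B * x ^+ 2 + 2 * x * sqrtab) * fpsX
           + fpsC (A * B * x ^+ 3 * sqrtab) * fpsX ^+ 2)^-1
        *: (map_mx (@fpsC K) (sqrtbx *: F 0%N)
            + fpsX *: map_mx (@fpsC K)
                ((A * x * sqrtbx) *: F 1%N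
                 - (B * x * sqrtax + A * B * x ^+ 2 * sqrtbx) *: F 0%N))
    & forall r3 r4 : K,
        (forall r : K,
           r ^+ 2 - (2 * x * sqrtab + A * B * x ^+ 2) * r
             + x ^+ 3 * A * B * sqrtab = 0 <-> r = r3 \/ r = r4) ->
        r3 - r4 = x * sqrtab * sqrtD ->
        let C := (2 * sqrtD)^-1 *:
          ((B * x * sqrtax) *: F 0%N - (2 * sqrtax) *: F 1%N) in
        forall n : nat,
          w n = (r4 ^+ n - r3 ^+ n) *: C
                + (r4 ^+ n + r3 ^+ n) *: (2^-1 *: (sqrtbx *: F 0%N))].
Proof.
move=> A B x sqrtab sqrtax sqrtbx F calA k w.
pose phi : {rmorphism {poly R} -> K} := iota \o @tofrac {poly R}.
have phiE p : polyK iota p = phi p by [].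
have phi_inj p : (phi p == 0) = (p == 0).
  by rewrite /= fmorph_eq0 tofrac_eq0.
have recA n : calA n.+2 = k *: calA n.+1 + calA n.
  exact: (@weighted_bifib_rec _ _ phi).
have k2E : k ^+ 2 = A * B * x ^+ 2.
  by rewrite /k /sqrtab /A /B -sqrtaE -sqrtbE; ring.
have k3E : k ^+ 3 = A * B * x ^+ 3 * sqrtab by rewrite exprS k2E /k; ring.
have kaxE : k * sqrtax = A * x * sqrtbx.
  by rewrite /k /sqrtab /sqrtax /sqrtbx /A -sqrtaE; ring.
have kbxE : k * sqrtbx = B * x * sqrtax.
  by rewrite /k /sqrtab /sqrtax /sqrtbx /B -sqrtbE; ring.
have pE : A * B * x ^+ 2 + 2 * x * sqrtab = k ^+ 2 + 2 * k.
  by rewrite k2E /k; ring.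
have recw n : w n.+2 = (k ^+ 2 + 2 * k) *: w n.+1 - k ^+ 3 *: w n.
  exact: kbinomial_rec.
have calA0 : calA 0%N = sqrtbx *: F 0%N.
  by rewrite /calA expr0 expr1 mulr1 mulrC.
have calA1 : calA 1%N = sqrtax *: F 1%N.
  by rewrite /calA expr0 expr1 mulr1 mulrC.
have w0 : w 0%N = sqrtbx *: F 0%N by rewrite -calA0; exact: kbinomial0.
have w1 : w 1%N = k *: (sqrtbx *: F 0%N + sqrtax *: F 1%N).
  by rewrite -calA0 -calA1; exact: kbinomial1.
split.
- by case=> // n _; rewrite pE -k3E recw.
- rewrite pE -k3E (mxseries_rec recw) w0 w1; congr (_ *: (_ + _ *: map_mx _ _)).
  rewrite -kaxE -kbxE -k2E.
  (* The body of F is cleared to keep mxE from unfolding the matrix F 1. *)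
  clearbody F.
  by apply/matrixP => i j; rewrite !mxE; ring.
move=> r3 r4 rootsE r34 C n.
have nz2 : 2 != 0 :> K.
  rewrite -[2](rmorph_nat phi) phi_inj -polyC_natr polyC_eq0.
  by rewrite Num.Theory.pnatr_eq0.
have k_neq0 : k != 0.
  rewrite -sqrf_eq0 k2E !mulf_eq0 /A /B /x !phiE !phi_inj.
  by rewrite !polyC_eq0 polyX_eq0 (negPf a_neq0) (negPf b_neq0).
have D_neq0 : sqrtD != 0.
  rewrite -sqrf_eq0 sqrtDE phiE phi_inj.
  apply/eqP => /(congr1 (fun p : {poly R} => p`_0)) /eqP.
  by rewrite coefD coefZ coefXn coefC coef0 mulr0 add0r Num.Theory.pnatr_eq0.
have charE r : r ^+ 2 - (k ^+ 2 + 2 * k) * r + k ^+ 3 =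
    r ^+ 2 - (2 * x * sqrtab + A * B * x ^+ 2) * r + x ^+ 3 * A * B * sqrtab.
  by rewrite k3E k2E /k; ring.
have r3E : r3 ^+ 2 - (k ^+ 2 + 2 * k) * r3 + k ^+ 3 = 0.
  by rewrite charE; apply/rootsE; left.
have r4E : r4 ^+ 2 - (k ^+ 2 + 2 * k) * r4 + k ^+ 3 = 0.
  by rewrite charE; apply/rootsE; right.
(* Subtracting the two equations gives (r3 - r4) * (r3 + r4 - (k^2 + 2k)) = 0. *)
have sumE : r3 + r4 = k ^+ 2 + 2 * k.
  have r34_neq0 : r3 - r4 != 0 by rewrite r34 mulf_neq0.
  apply/eqP; rewrite -subr_eq0 -(mulrI_eq0 _ (mulfI r34_neq0)).
  by rewrite -[0](subrr 0) -{1}r3E -r4E; apply/eqP; ring.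
(* The closed form regroups as r4 ^+ l *: (H + C) + r3 ^+ l *: (H - C). *)
pose H := 2^-1 *: (sqrtbx *: F 0%N).
have kDC : (k * sqrtD) *: C
    = 2^-1 *: (k ^+ 2 *: (sqrtbx *: F 0%N)) - k *: (sqrtax *: F 1%N).
  rewrite /C -kbxE; clearbody F; apply/matrixP => i j; rewrite !mxE.
  by field; rewrite nz2 D_neq0.
have wE : forall l, w l = r4 ^+ l *: (H + C) + r3 ^+ l *: (H - C).
  apply: (binet_rec recw r4E r3E).
    rewrite w0 addrACA subrr addr0 /H; clearbody F.
    by apply/matrixP => i j; rewrite !mxE; field; rewrite nz2.
  have -> : r4 *: (H + C) + r3 *: (H - C) = (r3 + r4) *: H - (r3 - r4) *: C.
    by clearbody H C; apply/matrixP => i j; rewrite !mxE; ring.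
  rewrite sumE r34 -/k kDC w1 /H; clearbody F.
  by apply/matrixP => i j; rewrite !mxE; field; rewrite nz2.
rewrite wE -/H; clearbody H C.
by apply/matrixP => i j; rewrite !mxE; ring.
Qed.
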